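(* Let $D$ be a finite or infinite digraph and let $A\subseteq X(D)$. (a) The following are equivalent: (i) $A$ is a point-reaching set of $D$; (ii) $A^*$ is a point-reaching set of the condensation $D^*$; (iii) $A$ contains at least one vertex from each initial strong component of $D$, and $A\cap R'(u)\neq\emptyset$ for every vertex $u$ of $D$ whose shadow $R'(u)$ contains no initial strong component of $D$; (iv) $A$ contains at least one vertex from each initial strong component of $D$, and $A\cap R'(u)$ is infinite for every vertex $u$ of $D$ whose shadow $R'(u)$ contains no initial strong component of $D$. (b) Every point-basis of $D$ (if one exists) consists of exactly one vertex from each initial strong component of $D$ and no other vertices.
   Context: $D$ is a digraph with vertex set $X(D)$ (arcs are ordered pairs of distinct vertices), possibly infinite. $v$ is reachable from $u$ if there is a directed path (possibly of length $0$) from $u$ to $v$. The shadow of $u$ is $R'(u)=\{z\in X(D): u \text{ is reachable from } z\}$. A strong component is a maximal subdigraph in which every vertex is reachable from every other; it is initial if no arc of $D$ enters it from outside. The condensation $D^*$ has one vertex for each strong component of $D$, with an arc $(C_1,C_2)$ iff $C_1\ne C_2$ and some arc $(u,v)$ of $D$ has $u\in C_1$, $v\in C_2$. For $S\subseteq X(D)$, $S^*$ is the set of strong components of $D$ meeting $S$ (a vertex set of $D^*$). A point-reaching set of a digraph is a vertex set $S$ such that every vertex is reachable from some vertex of $S$; a point-basis is an inclusion-minimal point-reaching set. *)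

(* Defs.v *)
From Stdlib Require List.
From mathcomp Require Import all_boot.
From mathcomp Require Import boolp classical_sets cardinality.

Set Implicit Arguments.
Unset Strict Implicit.
Unset Printing Implicit Defensive.

Local Open Scope classical_set_scope.

Record digraph := Digraph {
  vertex :> Type;
  arc : vertex -> vertex -> Prop;
  arc_irrefl : forall u, ~ arc u u }.

Fixpoint walk (T : Type) (e : T -> T -> Prop) (u : T) (p : seq T) : Prop :=
  if p is v :: q then e u v /\ walk e v q else True.

(* The path has vertex sequence [u :: p], hence length [size p]. *)
Definition dipath (T : Type) (e : T -> T -> Prop) (u : T) (p : seq T) : Prop :=
  walk e u p /\ List.NoDup (u :: p).

Definition joined (T : Type) (e : T -> T -> Prop) (u v : T) : Prop :=
  exists2 p, dipath e u p & last u p = v.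

Definition reachable (D : digraph) (u v : D) : Prop := joined (@arc D) u v.

Definition shadow (D : digraph) (u : D) : set D := [set z | reachable z u].

Record subdigraph (D : digraph) := Subdigraph {
  sub_vertex : set D;
  sub_arc : D -> D -> Prop;
  sub_arcP : forall u v,
    sub_arc u v -> [/\ arc u v, sub_vertex u & sub_vertex v] }.

Definition subdigraph_le (D : digraph) (H K : subdigraph D) : Prop :=
  sub_vertex H `<=` sub_vertex K /\
  (forall u v, sub_arc H u v -> sub_arc K u v).

(* Nonemptiness matters only for the digraph with no vertices, which has no
   strong component. *)
Definition strong (D : digraph) (H : subdigraph D) : Prop :=
  sub_vertex H !=set0 /\
  (forall u v, sub_vertex H u -> sub_vertex H v -> joined (sub_arc H) u v).

Definition strong_component (D : digraph) (H : subdigraph D) : Prop :=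
  strong H /\ (forall K, strong K -> subdigraph_le H K -> subdigraph_le K H).

Definition component (D : digraph) := {H : subdigraph D | strong_component H}.

Definition component_vertex (D : digraph) (C : component D) : set D :=
  sub_vertex (proj1_sig C).

Definition initial (D : digraph) (C : component D) : Prop :=
  ~ exists u v, [/\ arc u v, ~ component_vertex C u & component_vertex C v].

Definition condensation_arc (D : digraph) (C1 C2 : component D) : Prop :=
  C1 <> C2 /\
  exists u v, [/\ arc u v, component_vertex C1 u & component_vertex C2 v].

Lemma condensation_arc_irrefl (D : digraph) (C : component D) :
  ~ condensation_arc C C.
Proof. by case. Qed.

Definition condensation (D : digraph) : digraph :=
  Digraph (@condensation_arc_irrefl D).

Definition star (D : digraph) (S : set D) : set (condensation D) :=
  [set C : component D | S `&` component_vertex C !=set0].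

Definition point_reaching (D : digraph) (S : set D) : Prop :=
  forall v : D, exists2 u, S u & reachable u v.

Definition point_basis (D : digraph) (S : set D) : Prop :=
  point_reaching S /\
  (forall T : set D, T `<=` S -> point_reaching T -> T = S).

Definition meets_initial (D : digraph) (A : set D) : Prop :=
  forall C : component D, initial C -> A `&` component_vertex C !=set0.

Definition shadow_without_initial (D : digraph) (u : D) : Prop :=
  ~ exists C : component D, initial C /\ component_vertex C `<=` shadow u.

(* Main.v *)
(** Passing to strong components preserves and reflects reachability, whence
    (i) <-> (ii).  The component of [u] is initial exactly when it contains the
    shadow of [u], so a point-reaching set meets every initial component.  If
    the shadow of [u] contains no initial component, neither does the shadow of
    any [a] in it, so some vertex reaches [a] without being reachable from [a],
    and [A] has a point reaching that vertex.  Hence [A `&` shadow u] has no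
    minimal point for the reachability quasi-order, and cannot be finite.  For
    (b), no point of a point-basis reaches another one, since the latter could
    be discarded. *)
Require Import Defs.
From Stdlib Require List.
From Stdlib Require Import Relation_Operators Operators_Properties.
From mathcomp Require Import all_boot.
From mathcomp Require Import boolp classical_sets cardinality.

Set Implicit Arguments.
Unset Strict Implicit.
Unset Printing Implicit Defensive.

Local Open Scope classical_set_scope.

Lemma finite_set_minimal (T : Type) (r : T -> T -> Prop) (X : set T) :
    (forall x y z, r x y -> r y z -> r x z) -> finite_set X -> X !=set0 ->
  exists2 m, X m & forall x, X x -> r x m -> r m x.
Proof.
move=> r_trans /(@finite_seqP {classic T})[s ->].
elim: s => [[]//|a s IHs _].
have [/IHs[m sm m_min]|s_empty] := pselect ([set` s] !=set0); last first.
  exists a => [|x]; first exact: mem_head.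
  by rewrite /= inE => /orP[/eqP->//|sx]; case: s_empty; exists x.
have [am|nam] := pselect (r a m).
  exists a => [|x]; first exact: mem_head.
  rewrite /= inE => /orP[/eqP->//|sx] xa.
  exact: r_trans am (m_min _ sx (r_trans _ _ _ xa am)).
exists m => [|x]; first by rewrite /= inE sm orbT.
by rewrite /= inE => /orP[/eqP->//|]; exact: m_min.
Qed.

Section Joined.
Variables (T : Type) (e : T -> T -> Prop).
Implicit Types (u v w x : T) (p q : seq T).

Lemma joined_refl u : joined e u u.
Proof.
exists [::] => //; split=> //=.
by constructor; [case | constructor].
Qed.

Lemma dipath_behead u v p : dipath e u (v :: p) -> dipath e v p.
Proof. by move=> [[_ walk_p] /List.NoDup_cons_iff[_ nodup_p]]; split. Qed.

Lemma dipath_suffix u x q p : dipath e u (q ++ x :: p) -> dipath e x p.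
Proof. by elim: q u => [|y q IHq] u /dipath_behead; last exact: IHq. Qed.

Lemma joined_cons u v w : e u v -> joined e v w -> joined e u w.
Proof.
move=> uv [p path_p last_p].
have [|u_notin] := pselect (List.In u (v :: p)); last first.
  by exists (v :: p) => //; case: path_p => walk_p ?; split=> //; constructor.
case=> [<-|/(@List.in_split _ _ _)[q1 [q2 pE]]]; first by exists p.
rewrite pE in path_p last_p; exists q2; first exact: dipath_suffix path_p.
by rewrite -last_p last_cat.
Qed.

Lemma walk_clos_refl_trans u p : walk e u p -> clos_refl_trans T e u (last u p).
Proof.
elim: p u => [|v p IHp] u /=; first by move=> _; exact: rt_refl.
by move=> [uv /IHp vp]; exact: rt_trans (rt_step _ _ _ _ uv) vp.
Qed.

Lemma joinedP u v : joined e u v <-> clos_refl_trans T e u v.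
Proof.
split=> [[p [walk_p _] <-]|]; first exact: walk_clos_refl_trans.
move: u; apply: clos_refl_trans_ind_right; first exact: joined_refl.
by move=> u w uw wv _; exact: joined_cons uw wv.
Qed.

Lemma joined_step u v : e u v -> joined e u v.
Proof. by move=> uv; apply/joinedP; exact: rt_step. Qed.

Lemma joined_trans u v w : joined e u v -> joined e v w -> joined e u w.
Proof. by rewrite !joinedP; exact: rt_trans. Qed.

Lemma joined_ind v (P : T -> Prop) :
    P v -> (forall u w, e u w -> joined e w v -> P w -> P u) ->
  forall u, joined e u v -> P u.
Proof.
move=> Pv Pstep u /joinedP; move: u; apply: clos_refl_trans_ind_right => //.
by move=> u w uw Pw /joinedP wv; exact: Pstep uw wv Pw.
Qed.

End Joined.

Lemma joined_homo (T U : Type) (e : T -> T -> Prop) (r : U -> U -> Prop)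
    (f : T -> U) (u v : T) :
    (forall x y, e x y -> joined r (f x) (f y)) ->
  joined e u v -> joined r (f u) (f v).
Proof.
move=> f_homo; move: u; apply: joined_ind; first exact: joined_refl.
by move=> x y /f_homo xy _; exact: joined_trans.
Qed.

Lemma subdigraph_le_anti (D : digraph) (H K : subdigraph D) :
  subdigraph_le H K -> subdigraph_le K H -> H = K.
Proof.
case: H K => [vH aH pH] [vK aK pK] [/= vHK aHK] [/= vKH aKH].
have vE : vH = vK by apply/seteqP; split.
have aE : aH = aK.
  by apply/funext => x; apply/funext => y; apply/propext; split; auto.
subst vK aK; congr Subdigraph; exact: Prop_irrelevance.
Qed.

Section InducedSubdigraph.
Variables (D : digraph) (S : set D).

Definition induced_arc (u v : D) : Prop := [/\ Defs.arc u v, S u & S v].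

Definition induced_subdigraph : subdigraph D :=
  @Subdigraph D S induced_arc (fun _ _ => id).

Lemma joined_induced_arc (u v : D) :
    (forall w, reachable u w -> reachable w v -> S w) ->
  reachable u v -> joined induced_arc u v.
Proof.
move=> + uv; move: u uv; apply: joined_ind => [_|u w uw wv IHw Suv].
  exact: joined_refl.
have uv := joined_cons uw wv.
apply: (@joined_cons _ _ u w).
  by split=> //; apply: Suv => //; [exact: joined_refl | exact: joined_step].
by apply: IHw => x wx; apply: Suv; exact: joined_cons uw wx.
Qed.

End InducedSubdigraph.

Section StrongComponents.
Variable D : digraph.
Implicit Types (u v x y : D) (H K : subdigraph D) (C : component D).

Definition strong_class u : set D := [set v | reachable u v /\ reachable v u].

Lemma strong_class_refl u : strong_class u u.
Proof. by split; exact: joined_refl. Qed.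

Definition component_subdigraph u : subdigraph D :=
  induced_subdigraph (strong_class u).

Lemma component_subdigraph_strong u : strong (component_subdigraph u).
Proof.
split=> [|x y [ux xu] [uy yu]]; first by exists u; exact: strong_class_refl.
apply: joined_induced_arc => [w xw wy|]; last exact: joined_trans xu uy.
by split; [exact: joined_trans ux xw | exact: joined_trans wy yu].
Qed.

Lemma strong_reachable H u v :
  strong H -> sub_vertex H u -> sub_vertex H v -> reachable u v.
Proof.
move=> [_ H_joined] Hu Hv.
apply: (@joined_homo _ _ _ _ id) (H_joined _ _ Hu Hv).
by move=> x y /sub_arcP[xy _ _]; exact: joined_step.
Qed.

Lemma strong_le_component_subdigraph H u :
  strong H -> sub_vertex H u -> subdigraph_le H (component_subdigraph u).
Proof.
move=> strongH Hu.
have H_class x : sub_vertex H x -> strong_class u x.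
  by move=> Hx; split; exact: strong_reachable strongH _ _.
by split=> // x y /sub_arcP[xy /H_class ? /H_class ?].
Qed.

Lemma component_subdigraphP u : strong_component (component_subdigraph u).
Proof.
split=> [|K strongK [classK _]]; first exact: component_subdigraph_strong.
apply: strong_le_component_subdigraph strongK _.
exact: classK (strong_class_refl u).
Qed.

Definition component_of u : component D := exist _ _ (component_subdigraphP u).

Lemma mem_component_of u : component_vertex (component_of u) u.
Proof. exact: strong_class_refl. Qed.

Lemma component_ofE C u : component_vertex C u -> C = component_of u.
Proof.
case: C => H [strongH maxH] Hu.
have H_le := strong_le_component_subdigraph strongH Hu.
apply: eq_exist; apply: subdigraph_le_anti => //.
exact: maxH (component_subdigraph_strong u) H_le.
Qed.

Lemma component_nonempty C : component_vertex C !=set0.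
Proof. by case: C => H [[]]. Qed.

Lemma component_reachable C u v :
  component_vertex C u -> component_vertex C v -> reachable u v.
Proof. by move=> /component_ofE-> []. Qed.

Lemma reachable_condensation C1 C2 u v :
    component_vertex C1 u -> component_vertex C2 v ->
  @reachable (condensation D) C1 C2 <-> reachable u v.
Proof.
move=> C1u C2v; split=> [C12|uv]; last first.
  rewrite (component_ofE C1u) (component_ofE C2v).
  apply: (@joined_homo D (condensation D)) uv => x y xy.
  have [->|xy_neq] := pselect (component_of x = component_of y).
    exact: joined_refl.
  apply: joined_step; split=> //; exists x, y.
  by split=> //; exact: mem_component_of.
move: C1 C12 u C1u; apply: joined_ind => [u C2u|].
  exact: component_reachable C2u C2v.
move=> C C' [_ [x [y [xy Cx C'y]]]] _ IHC' u Cu.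
apply: joined_trans (component_reachable Cu Cx) _.
exact: joined_cons xy (IHC' _ C'y).
Qed.

Lemma initial_shadowP C u :
  component_vertex C u -> initial C <-> shadow u `<=` component_vertex C.
Proof.
move=> Cu; split=> [initC|shadowC [x [y [xy nCx Cy]]]].
  apply: joined_ind => // x y xy _ Cy.
  by apply: contrapT => nCx; apply: initC; exists x, y.
apply: nCx; apply: shadowC.
exact: joined_cons xy (component_reachable Cy Cu).
Qed.

Lemma shadow_subset u v : reachable u v -> shadow u `<=` shadow v.
Proof. by move=> uv x xu; exact: joined_trans xu uv. Qed.

Lemma shadow_without_initial_reachable u v :
  reachable u v -> shadow_without_initial v -> shadow_without_initial u.
Proof.
move=> uv noinit [C [initC C_shadow]]; apply: noinit; exists C; split=> //.
exact: subset_trans (shadow_subset uv).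
Qed.

Lemma shadow_without_initial_irreversible u :
  shadow_without_initial u -> exists2 x, reachable x u & ~ reachable u x.
Proof.
move=> noinit; apply: contrapT => reversible; apply: noinit.
exists (component_of u); split=> [|x []//].
apply/(initial_shadowP (mem_component_of u)) => x xu; split=> //.
by apply: contrapT => nux; apply: reversible; exists x.
Qed.

End StrongComponents.

Section PointReaching.
Variables (D : digraph) (A : set D).

Lemma point_reaching_star : point_reaching A <-> point_reaching (star A).
Proof.
split=> [reachA C|reachA v].
  have [v Cv] := component_nonempty C; have [a Aa av] := reachA v.
  exists (component_of a).
    by exists a; split=> //; exact: mem_component_of.
  exact/(reachable_condensation (mem_component_of a) Cv).
have [C [a [Aa Ca]] Cv] := reachA (component_of v); exists a => //.
exact/(reachable_condensation Ca (mem_component_of v)).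
Qed.

Lemma point_reaching_meets_initial : point_reaching A -> meets_initial A.
Proof.
move=> reachA C initC; have [v Cv] := component_nonempty C.
have [a Aa av] := reachA v.
by exists a; split=> //; exact: (initial_shadowP Cv).1 initC _ av.
Qed.

Lemma meets_initial_point_reaching :
    meets_initial A ->
    (forall u : D, shadow_without_initial u -> A `&` shadow u !=set0) ->
  point_reaching A.
Proof.
move=> A_init A_shadow v.
suff [a [Aa av]] : A `&` shadow v !=set0 by exists a.
have [/A_shadow//|/contrapT[C [initC C_shadow]]] :=
  pselect (shadow_without_initial v).
by have [a [Aa Ca]] := A_init _ initC; exists a; split=> //; exact: C_shadow.
Qed.

Lemma infinite_setI_shadow (u : D) :
    (forall v : D, shadow_without_initial v -> A `&` shadow v !=set0) ->
  shadow_without_initial u -> infinite_set (A `&` shadow u).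
Proof.
move=> A_shadow noinit fin.
have [a [Aa au] a_min] :=
  finite_set_minimal (@joined_trans _ (@Defs.arc D)) fin (A_shadow _ noinit).
have noinit_a := shadow_without_initial_reachable au noinit.
have [x xa nax] := shadow_without_initial_irreversible noinit_a.
have [b [Ab bx]] := A_shadow _ (shadow_without_initial_reachable xa noinit_a).
have ba : reachable b a := joined_trans bx xa.
apply: nax; apply: joined_trans bx; apply: a_min => //.
by split=> //; exact: joined_trans ba au.
Qed.

End PointReaching.

Section PointBasis.
Variables (D : digraph) (B : set D).
Hypothesis basisB : point_basis B.

Lemma point_basis_antichain (x y : D) : B x -> B y -> reachable x y -> x = y.
Proof.
have [reachB minB] := basisB; move=> Bx By xy; apply: contrapT => x_neq_y.
suff BE : B `\ y = B by move: By; rewrite -BE => -[_]; exact.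
apply: minB => [z []//|v]; have [b Bb bv] := reachB v.
have [bE|b_neq_y] := pselect (b = y); last by exists b.
by exists x => //; apply: joined_trans xy _; rewrite -bE.
Qed.

Lemma point_basis_unique_in_initial (C : component D) :
  initial C -> exists! x : D, B x /\ component_vertex C x.
Proof.
move=> /(point_reaching_meets_initial basisB.1)[x [Bx Cx]].
exists x; split=> // y [By Cy].
exact: point_basis_antichain Bx By (component_reachable Cx Cy).
Qed.

Lemma point_basis_initial (x : D) : B x -> initial (component_of x).
Proof.
move=> Bx; apply/(initial_shadowP (mem_component_of x)) => y yx; split=> //.
have [b Bb b_y] := basisB.1 y.
by rewrite -(point_basis_antichain Bb Bx (joined_trans b_y yx)).
Qed.

End PointBasis.

Theorem theorem14 (D : digraph) (A : set D) :
  [<-> point_reaching A;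
       point_reaching (star A);
       meets_initial A /\
         (forall u : D, shadow_without_initial u -> A `&` shadow u !=set0);
       meets_initial A /\
         (forall u : D, shadow_without_initial u ->
            infinite_set (A `&` shadow u))]
  /\
  (forall B : set D, point_basis B ->
     (forall C : component D, initial C ->
        exists! x : D, B x /\ component_vertex C x) /\
     (forall x : D, B x ->
        exists C : component D, initial C /\ component_vertex C x)).
Proof.
split=> [|B basisB].
  tfae.
  - exact: (point_reaching_star A).1.
  - move=> /(point_reaching_star A).2 reachA.
    split=> [|u _]; first exact: point_reaching_meets_initial.
    by have [a Aa au] := reachA u; exists a.
  - by move=> [A_init A_shadow]; split=> // u; exact: infinite_setI_shadow.
  - move=> [A_init A_shadow]; apply: meets_initial_point_reaching => // u.
    by move=> /A_shadow/infinite_setN0.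
split=> [C|x Bx]; first exact: point_basis_unique_in_initial.
exists (component_of x); split; last exact: mem_component_of.
exact: (point_basis_initial basisB Bx).
Qed.
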